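(* There is a constant $C>0$, independent of $n$, $f$, $g$ and $x$, such that for all real-valued $f,g\in C^{1}[0,1]$, all $n\ge1$ and all $x\in[0,1]$, $$n\left|B_{n}(fg)(x)-B_{n}(f)(x)B_{n}(g)(x)-\frac{x(1-x)}{n}f'(x)g'(x)\right|\le C\,x(1-x)\Big\{\omega_{3}\big(f';n^{-1/6}\big)\,\omega_{3}\big(g';n^{-1/6}\big)$$ $$+\|f'\|\,\omega_{3}\big(g';n^{-1/6}\big)+\|g'\|\,\omega_{3}\big(f';n^{-1/6}\big)+\max\Big\{\frac{\|f\|}{n^{1/2}},\omega_{3}\big(f';n^{-1/6}\big)\Big\}\cdot\max\Big\{\frac{\|g\|}{n^{1/2}},\omega_{3}\big(g';n^{-1/6}\big)\Big\}\Big\}.$$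
   Context: For $f:[0,1]\to\mathbb{R}$ the Bernstein polynomials are $B_{n}(f)(x)=\sum_{k=0}^{n}\binom{n}{k}x^{k}(1-x)^{n-k}f(k/n)$. $\|\cdot\|$ denotes the uniform norm on $C[0,1]$. For $h\in C[0,1]$ and $\delta>0$, $\omega_{3}(h;\delta)=\sup\{|h(x+3t)-3h(x+2t)+3h(x+t)-h(x)| : 0<t\le\delta,\ x,x+3t\in[0,1]\}$ is the third-order modulus of smoothness. *)

(* Defs.v *)
From Stdlib Require Import Reals Lra.
From Coquelicot Require Import Coquelicot.
Open Scope R_scope.

Definition bernstein (n : nat) (f : R -> R) (x : R) : R :=
  sum_f_R0 (fun k => Binomial.C n k * x ^ k * (1 - x) ^ (n - k) * f (INR k / INR n)) n.

Definition unorm (h : R -> R) : R :=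
  real (Lub_Rbar (fun r => exists x, 0 <= x <= 1 /\ r = Rabs (h x))).

Definition omega3 (h : R -> R) (delta : R) : R :=
  real (Lub_Rbar (fun r => exists x t, 0 < t <= delta /\ 0 <= x /\ x + 3 * t <= 1 /\
     r = Rabs (h (x + 3 * t) - 3 * h (x + 2 * t) + 3 * h (x + t) - h x))).

Definition C1_on01 (f df : R -> R) : Prop :=
  (forall x, 0 <= x <= 1 ->
     limit1_in (fun y => (f y - f x) / (y - x)) (fun y => 0 <= y <= 1 /\ y <> x) (df x) x) /\
  (forall x, 0 <= x <= 1 -> limit1_in df (fun y => 0 <= y <= 1) (df x) x).

(* Main.v *)
(** B_n(f)(x) is the expectation of f(K/n) for K binomial, so the left-hand side is the
    bilinear form E(f,g) = n Cov(f(K/n), g(K/n)) - x(1-x) f'(x) g'(x). It satisfies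
    |E(f,g)| <= 3 x(1-x) Lip(f) Lip(g), and for smooth u, v a Taylor expansion with the
    central moments up to order 4 gives |E(u,v)| <= 9 x(1-x) M(u) M(v) / n, where M bounds
    the first three derivatives. A combination of iterated Steklov means of f' produces u
    with |f' - u'| <= w and |u^(4)| <= C n^(1/2) w, where w = omega3(f'; n^(-1/6)); Landau's
    inequality then bounds the intermediate derivatives: M(u) <= C (|f| + n^(1/2) w).
    Expand E(f,g) along f = (f - u) + u and g = (g - v) + v. *)

(* The exponent 1/6 comes from the balance [h ^ 3 = n^(-1/2)]: smoothing at scale [h] costs a factor
   [1 / h ^ 3] in the third derivative of [u'], so [M(u)] is of order
   [sqrt n * max(|f| / sqrt n, w)], and the division by [n] in the smooth estimate turns [M(u) M(v)]
   into the product of the two maxima. The mixed terms cannot use [M(v)], which may grow like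
   [sqrt n]; there [v] enters through [|v'| <= |g'| + omega3(g'; n^(-1/6))], whence the terms with
   one norm and one modulus. The factor [x (1 - x)] survives because the central moments of orders
   two to four all carry it. Two obstacles come from the interval. Ordinary Steklov means sample
   outside [[0,1]], where [omega3] controls nothing, so the argument is contracted before averaging.
   And differentiability at 0 and 1 is one-sided, whereas integrals and derivatives are taken on the
   whole line; [f] and [g] are therefore replaced by extensions, while bounds are still asked on
   [[0,1]] only. *)
Require Import Defs.
From Stdlib Require Import Reals Lra Lia.
From Coquelicot Require Import Coquelicot.
Open Scope R_scope.

(** * Binomial expectations and central moments *)

(* Expectation of [phi] under the binomial law [B(n, x)], by conditioning on the last trial. *)
Fixpoint binexp (x : R) (n : nat) (phi : nat -> R) : R :=
  match n with
  | O => phi O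
  | S m => x * binexp x m (fun k => phi (S k)) + (1 - x) * binexp x m phi
  end.

(** Conditioning on the last trial is Pascal's rule. The rule covers interior indices only, so the
    end terms are split off and matched by hand. *)
Lemma binexp_sum (x : R) (n : nat) (phi : nat -> R) :
  sum_f_R0 (fun k => Binomial.C n k * x ^ k * (1 - x) ^ (n - k) * phi k) n
  = binexp x n phi.
Proof.
revert phi; induction n as [|n IH]; intros phi.
  simpl; unfold Binomial.C; simpl; field.
simpl binexp; rewrite <- !IH.
assert (C0 : forall m, Binomial.C m 0 = 1).
  intros m; unfold Binomial.C; rewrite Nat.sub_0_r; simpl; field; apply INR_fact_neq_0.
assert (Cn : forall m, Binomial.C m m = 1).
  intros m; unfold Binomial.C; rewrite Nat.sub_diag; simpl; field; apply INR_fact_neq_0.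
(* A single trial has two end terms and no interior one; [split_ends] needs at least two trials. *)
destruct n as [|m].
  simpl; rewrite !C0, Cn; ring.
assert (split_ends : forall u : nat -> R,
  sum_f_R0 u (S (S m)) = u O + sum_f_R0 (fun i => u (S i)) m + u (S (S m))).
  intros u; rewrite tech5, decomp_sum by lia; reflexivity.
rewrite split_ends, tech5.
rewrite (decomp_sum (fun k => _ * phi k)) by lia.
simpl pred.
rewrite !C0, !Cn, !Nat.sub_0_r, !Nat.sub_diag.
rewrite (sum_eq (fun i => Binomial.C (S (S m)) (S i) * x ^ S i * (1 - x) ^ (S (S m) - S i) * phi (S i))
  (fun i => Binomial.C (S m) i * x ^ i * (1 - x) ^ (S m - i) * phi (S i) * x
   + Binomial.C (S m) (S i) * x ^ S i * (1 - x) ^ (S m - S i) * phi (S i) * (1 - x))).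
  rewrite sum_plus, <- !scal_sum.
  simpl; ring.
intros i Hi.
rewrite <- pascal by lia.
replace (S (S m) - S i)%nat with (S (m - i)) by lia.
replace (S m - i)%nat with (S (m - i)) by lia.
replace (S m - S i)%nat with (m - i)%nat by lia.
simpl; ring.
Qed.

Lemma binexp_ext (x : R) (n : nat) (a b : nat -> R) :
  (forall k, (k <= n)%nat -> a k = b k) -> binexp x n a = binexp x n b.
Proof.
revert a b; induction n as [|n IH]; intros a b H; simpl.
  apply H; lia.
rewrite (IH (fun k => a (S k)) (fun k => b (S k))), (IH a b); try easy;
  intros k Hk; apply H; lia.
Qed.

Lemma binexp_plus (x : R) (n : nat) (a b : nat -> R) :
  binexp x n (fun k => a k + b k) = binexp x n a + binexp x n b.
Proof.
revert a b; induction n as [|n IH]; intros a b; simpl; [easy|].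
rewrite (IH a b), (IH (fun k => a (S k)) (fun k => b (S k))); ring.
Qed.

Lemma binexp_scal (x : R) (n : nat) (c : R) (a : nat -> R) :
  binexp x n (fun k => c * a k) = c * binexp x n a.
Proof.
revert a; induction n as [|n IH]; intros a; simpl; [easy|].
rewrite (IH a), (IH (fun k => a (S k))); ring.
Qed.

Lemma binexp_const (x : R) (n : nat) (c : R) : binexp x n (fun _ => c) = c.
Proof. induction n as [|n IH]; simpl; [easy|rewrite IH; ring]. Qed.

Lemma binexp_le (x : R) (n : nat) (a b : nat -> R) : 0 <= x <= 1 ->
  (forall k, (k <= n)%nat -> a k <= b k) -> binexp x n a <= binexp x n b.
Proof.
intros Hx; revert a b; induction n as [|n IH]; intros a b H; simpl.
  apply H; lia.
apply Rplus_le_compat; apply Rmult_le_compat_l; try lra; apply IH;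
  intros k Hk; apply H; lia.
Qed.

Lemma binexp_Rabs (x : R) (n : nat) (a b : nat -> R) : 0 <= x <= 1 ->
  (forall k, (k <= n)%nat -> Rabs (a k) <= b k) ->
  Rabs (binexp x n a) <= binexp x n b.
Proof.
intros Hx H; apply Rabs_le; split.
  replace (- binexp x n b) with (-1 * binexp x n b) by ring.
  rewrite <- binexp_scal; apply binexp_le; [easy|intros k Hk].
  generalize (proj1 (Rabs_le_between _ _) (H k Hk)); lra.
apply binexp_le; [easy|intros k Hk].
generalize (proj1 (Rabs_le_between _ _) (H k Hk)); lra.
Qed.

(** Nonnegativity of the variance: the mean of [(a k - m) ^ 2] is expanded by linearity. *)
Lemma binexp_sqr_le (x : R) (n : nat) (a : nat -> R) : 0 <= x <= 1 ->
  (binexp x n a) ^ 2 <= binexp x n (fun k => a k ^ 2).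
Proof.
intros Hx; set (m := binexp x n a).
assert (H : 0 <= binexp x n (fun k => (a k ^ 2 + (- 2 * m) * a k) + m ^ 2)).
  rewrite <- (binexp_const x n 0).
  apply binexp_le; [easy|intros k _]; generalize (pow2_ge_0 (a k - m)); lra.
rewrite binexp_plus, binexp_plus, binexp_scal, binexp_const in H.
fold m in H; lra.
Qed.

(** The last trial shifts the centred count by [1 - x] or by [- x], so the recursion evaluates
    moments of a shifted variable. [E1] to [E4] treat an arbitrary shift [c]; they draw on the lower
    moments, hence the joint induction. *)
Lemma binexp_moments (x : R) (n : nat) (X := x * (1 - x)) :
  binexp x n (fun k => INR k - INR n * x) = 0 /\
  binexp x n (fun k => (INR k - INR n * x) ^ 2) = INR n * X /\
  binexp x n (fun k => (INR k - INR n * x) ^ 3) = INR n * X * (1 - 2 * x) /\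
  binexp x n (fun k => (INR k - INR n * x) ^ 4)
  = 3 * (INR n * X) ^ 2 + INR n * X * (1 - 6 * X).
Proof.
induction n as [|n (H1 & H2 & H3 & H4)].
  simpl; unfold X; repeat split; ring.
assert (E1 : forall c, binexp x n (fun k => INR k - INR n * x + c) = c).
  intros c; rewrite binexp_plus, binexp_const, H1; ring.
assert (E2 : forall c, binexp x n (fun k => (INR k - INR n * x + c) ^ 2)
   = INR n * X + c ^ 2).
  intros c; rewrite (binexp_ext _ _ _ (fun k => (INR k - INR n * x) ^ 2
    + 2 * c * (INR k - INR n * x) + c ^ 2)) by (intros; ring).
  rewrite !binexp_plus, binexp_scal, binexp_const, H1, H2; ring.
assert (E3 : forall c, binexp x n (fun k => (INR k - INR n * x + c) ^ 3)
   = INR n * X * (1 - 2 * x) + 3 * c * (INR n * X) + c ^ 3).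
  intros c; rewrite (binexp_ext _ _ _ (fun k => (INR k - INR n * x) ^ 3
    + 3 * c * (INR k - INR n * x) ^ 2
    + 3 * c ^ 2 * (INR k - INR n * x) + c ^ 3)) by (intros; ring).
  rewrite !binexp_plus, !binexp_scal, binexp_const, H1, H2, H3; ring.
assert (E4 : forall c, binexp x n (fun k => (INR k - INR n * x + c) ^ 4)
   = 3 * (INR n * X) ^ 2 + INR n * X * (1 - 6 * X)
     + 4 * c * (INR n * X * (1 - 2 * x)) + 6 * c ^ 2 * (INR n * X) + c ^ 4).
  intros c; rewrite (binexp_ext _ _ _ (fun k => (INR k - INR n * x) ^ 4
    + 4 * c * (INR k - INR n * x) ^ 3
    + 6 * c ^ 2 * (INR k - INR n * x) ^ 2
    + 4 * c ^ 3 * (INR k - INR n * x) + c ^ 4)) by (intros; ring).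
  rewrite !binexp_plus, !binexp_scal, binexp_const, H1, H2, H3, H4; ring.
assert (up : forall k, INR (S k) - INR (S n) * x = INR k - INR n * x + (1 - x)).
  intros k; rewrite !S_INR; ring.
assert (dn : forall k, INR k - INR (S n) * x = INR k - INR n * x + - x).
  intros k; rewrite S_INR; ring.
cbn [binexp].
repeat split.
- rewrite (binexp_ext _ _ _ _ (fun k _ => up k)), (binexp_ext _ _ _ _ (fun k _ => dn k)).
  rewrite !E1; ring.
- rewrite (binexp_ext _ _ _ _ (fun k _ => f_equal (fun y => y ^ 2) (up k))),
    (binexp_ext _ _ _ _ (fun k _ => f_equal (fun y => y ^ 2) (dn k))).
  rewrite !E2, S_INR; unfold X; ring.
- rewrite (binexp_ext _ _ _ _ (fun k _ => f_equal (fun y => y ^ 3) (up k))),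
    (binexp_ext _ _ _ _ (fun k _ => f_equal (fun y => y ^ 3) (dn k))).
  rewrite !E3, S_INR; unfold X; ring.
- rewrite (binexp_ext _ _ _ _ (fun k _ => f_equal (fun y => y ^ 4) (up k))),
    (binexp_ext _ _ _ _ (fun k _ => f_equal (fun y => y ^ 4) (dn k))).
  rewrite !E4, S_INR; unfold X; ring.
Qed.

Definition dev (x : R) (n k : nat) : R := INR k / INR n - x.

(** One factor [X] is kept in each nonzero bound, so that the final estimate vanishes at the
    endpoints; the cofactors [1 - 2 * x] and [3 * X + (1 - 6 * X) / n] are bounded by constants. *)
Lemma dev_moments (x : R) (n : nat) (X := x * (1 - x)) :
  (1 <= n)%nat -> 0 <= x <= 1 ->
  binexp x n (dev x n) = 0 /\
  binexp x n (fun k => dev x n k ^ 2) = X / INR n /\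
  Rabs (binexp x n (fun k => dev x n k ^ 3)) <= X / INR n ^ 2 /\
  binexp x n (fun k => dev x n k ^ 4) <= 2 * X / INR n ^ 2.
Proof.
intros Hn Hx.
assert (HN : 1 <= INR n) by (apply (le_INR 1); lia).
destruct (binexp_moments x n) as (H1 & H2 & H3 & H4).
fold X in H2, H3, H4.
assert (Hd : forall m k, dev x n k ^ m = (/ INR n) ^ m * (INR k - INR n * x) ^ m).
  intros m k; rewrite <- Rpow_mult_distr; f_equal; unfold dev; field; lra.
assert (HX : 0 <= X <= 1 / 4).
  unfold X; split; [apply Rmult_le_pos; lra|generalize (pow2_ge_0 (x - 1/2)); lra].
assert (Hi : 0 < / INR n <= 1).
  split; [apply Rinv_0_lt_compat; lra|rewrite <- Rinv_1; apply Rinv_le_contravar; lra].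
repeat split.
- rewrite (binexp_ext _ _ _ (fun k => / INR n * (INR k - INR n * x)))
    by (intros; unfold dev; field; lra).
  rewrite binexp_scal, H1; ring.
- rewrite (binexp_ext _ _ _ _ (fun k _ => Hd 2%nat k)), binexp_scal, H2; field; lra.
- rewrite (binexp_ext _ _ _ _ (fun k _ => Hd 3%nat k)), binexp_scal, H3.
  replace (_ * _) with (X / INR n ^ 2 * (1 - 2 * x)) by (field; lra).
  assert (0 <= X / INR n ^ 2) by (apply Rmult_le_pos; [lra|rewrite <- pow_inv; apply pow_le; lra]).
  rewrite Rabs_mult, (Rabs_pos_eq (X / _)) by easy.
  rewrite <- (Rmult_1_r (X / _)) at 2; apply Rmult_le_compat_l; [easy|].
  apply Rabs_le; lra.
- rewrite (binexp_ext _ _ _ _ (fun k _ => Hd 4%nat k)), binexp_scal, H4.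
  replace (_ * _) with ((/ INR n) ^ 2 * X * (3 * X + / INR n * (1 - 6 * X)))
    by (field; lra).
  unfold Rdiv; rewrite <- pow_inv.
  replace (2 * X * _) with ((/ INR n) ^ 2 * X * 2) by ring.
  apply Rmult_le_compat_l; [apply Rmult_le_pos; [apply pow_le|]; lra|].
  nra.
Qed.

(** * Mean value estimates and Landau's inequality *)

Lemma mean_value (w dw : R -> R) (a b : R) : a <= b ->
  (forall z, is_derive w z (dw z)) ->
  exists c, a <= c <= b /\ w b - w a = dw c * (b - a).
Proof.
intros Hab H.
destruct (MVT_gen w a b dw) as (c & Hc & E).
- intros; apply H.
- intros z _; apply continuity_pt_filterlim, @ex_derive_continuous.
  exists (dw z); apply H.
- rewrite Rmin_left, Rmax_right in Hc by easy; exists c; easy.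
Qed.

(** The bound on [dw] is asked only at points no farther from [s] than [t]: in the Taylor estimates
    it is itself a power of [|t - x|], available only that close. *)
Lemma lipschitz_of_derive (w dw : R -> R) (l s t : R) :
  0 <= s <= 1 -> 0 <= t <= 1 ->
  (forall z, is_derive w z (dw z)) ->
  (forall z, 0 <= z <= 1 -> Rabs (z - s) <= Rabs (t - s) -> Rabs (dw z) <= l) ->
  Rabs (w t - w s) <= l * Rabs (t - s).
Proof.
intros Hs Ht Hw Hl.
assert (step : forall c, 0 <= c <= 1 -> Rabs (c - s) <= Rabs (t - s) ->
  Rabs (dw c * (t - s)) <= l * Rabs (t - s)).
  intros c Hc Hcs; rewrite Rabs_mult; apply Rmult_le_compat_r; [apply Rabs_pos|].
  now apply Hl.
destruct (Rle_or_lt s t) as [Hst|Hst].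
  destruct (mean_value w dw s t Hst Hw) as (c & Hc & ->); apply step; [lra|].
  rewrite !Rabs_pos_eq; lra.
destruct (mean_value w dw t s ltac:(lra) Hw) as (c & Hc & E).
replace (w t - w s) with (dw c * (t - s)) by lra; apply step; [lra|].
rewrite (Rabs_minus_sym c), (Rabs_minus_sym t), !Rabs_pos_eq; lra.
Qed.

Lemma small_derive_point (w dw : R -> R) (a p q : R) : p < q ->
  (forall z, is_derive w z (dw z)) ->
  Rabs (w p) <= a -> Rabs (w q) <= a ->
  exists c, p <= c <= q /\ Rabs (dw c) * (q - p) <= 2 * a.
Proof.
intros Hpq Hw Hp Hq.
destruct (mean_value w dw p q) as (c & Hc & E); [lra|easy|].
exists c; split; [easy|].
rewrite <- (Rabs_pos_eq (q - p)), <- Rabs_mult, <- E by lra.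
apply Rle_trans with (1 := Rabs_triang _ _); rewrite Rabs_Ropp; lra.
Qed.

Lemma bound_from_point (w dw : R -> R) (a l c : R) : 0 <= c <= 1 ->
  (forall z, is_derive w z (dw z)) -> Rabs (w c) <= a ->
  (forall z, 0 <= z <= 1 -> Rabs (dw z) <= l) ->
  forall z, 0 <= z <= 1 -> Rabs (w z) <= a + l.
Proof.
intros Hc Hw Ha Hl z Hz.
assert (H := lipschitz_of_derive w dw l c z Hc Hz Hw (fun y Hy _ => Hl y Hy)).
assert (0 <= l) by (apply Rle_trans with (2 := Hl c Hc); apply Rabs_pos).
assert (Hcz : Rabs (z - c) <= 1) by (apply Rabs_le; lra).
replace (w z) with (w c + (w z - w c)) by ring.
apply Rle_trans with (1 := Rabs_triang _ _).
generalize (Rmult_le_compat_l l _ _ H0 Hcz); lra.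
Qed.

(** Two points at distance at least 1/8 with small values of one derivative enclose a point where
    the next derivative is at most 16 times larger: [16 a], [256 a], [4096 a]. Integrating back from
    these points, with [w4] bounded by [b], adds them up to at most [4368 a + b]; 5000 is a
    rounding. *)
Lemma landau_bound (w w1 w2 w3 w4 : R -> R) (a b : R) :
  (forall z, is_derive w z (w1 z)) -> (forall z, is_derive w1 z (w2 z)) ->
  (forall z, is_derive w2 z (w3 z)) -> (forall z, is_derive w3 z (w4 z)) ->
  (forall z, 0 <= z <= 1 -> Rabs (w z) <= a) ->
  (forall z, 0 <= z <= 1 -> Rabs (w4 z) <= b) ->
  forall z, 0 <= z <= 1 ->
  Rabs (w1 z) <= 5000 * (a + b) /\ Rabs (w2 z) <= 5000 * (a + b) /\
  Rabs (w3 z) <= 5000 * (a + b).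
Proof.
intros H1 H2 H3 H4 Ha Hb.
assert (a0 : 0 <= a) by (apply Rle_trans with (2 := Ha 0 ltac:(lra)); apply Rabs_pos).
assert (b0 : 0 <= b) by (apply Rle_trans with (2 := Hb 0 ltac:(lra)); apply Rabs_pos).
assert (P1 : forall p, 0 <= p <= 7 / 8 ->
  exists c, p <= c <= p + 1 / 8 /\ Rabs (w1 c) <= 16 * a).
  intros p Hp; destruct (small_derive_point w w1 a p (p + 1 / 8)) as (c & Hc & E);
    try (apply Ha); try easy; try lra.
  exists c; split; [easy|lra].
assert (P2 : forall p, 0 <= p <= 5 / 8 ->
  exists c, p <= c <= p + 3 / 8 /\ Rabs (w2 c) <= 256 * a).
  intros p Hp; destruct (P1 p) as (c & Hc & Ec); [lra|].
  destruct (P1 (p + 1 / 4)) as (d & Hd & Ed); [lra|].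
  destruct (small_derive_point w1 w2 (16 * a) c d) as (e & He & E); try easy; try lra.
  exists e; split; [lra|].
  assert (Rabs (w2 e) * (1 / 8) <= Rabs (w2 e) * (d - c))
    by (apply Rmult_le_compat_l; [apply Rabs_pos|lra]).
  lra.
destruct (P1 0) as (c1 & Hc1 & E1); [lra|].
destruct (P2 0) as (c & Hc & Ec); [lra|].
destruct (P2 (1 / 2)) as (d & Hd & Ed); [lra|].
destruct (small_derive_point w2 w3 (256 * a) c d) as (e & He & E); try easy; try lra.
assert (Rabs (w3 e) * (1 / 8) <= Rabs (w3 e) * (d - c))
  by (apply Rmult_le_compat_l; [apply Rabs_pos|lra]).
assert (B3 := bound_from_point w3 w4 (4096 * a) b e ltac:(lra) H4 ltac:(lra) Hb).
assert (B2 := bound_from_point w2 w3 (256 * a) _ c ltac:(lra) H3 ltac:(lra) B3).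
assert (B1 := bound_from_point w1 w2 (16 * a) _ c1 ltac:(lra) H2 ltac:(lra) B2).
intros z Hz; specialize (B1 z Hz); specialize (B2 z Hz); specialize (B3 z Hz).
repeat split; lra.
Qed.

(** * Steklov means *)

Definition int_from0 (psi : R -> R) (y : R) : R := RInt psi 0 y.

Lemma int_from0_0 (psi : R -> R) : int_from0 psi 0 = 0.
Proof. exact (RInt_point 0 psi). Qed.

Lemma is_derive_int_from0 (psi : R -> R) : (forall z, continuous psi z) ->
  forall y, is_derive (int_from0 psi) y (psi y).
Proof.
intros H y; apply (is_derive_RInt psi _ 0); [|apply H].
exists (mkposreal 1 Rlt_0_1); intros z _.
apply (RInt_correct (V := R_CompleteNormedModule)), (ex_RInt_continuous (V := R_CompleteNormedModule)).
intros; apply H.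
Qed.

(** Mean of [psi] over [[y, y + c]], written with the primitive so that its derivative is a plain
    difference quotient. *)
Definition steklov (c : R) (psi : R -> R) (y : R) : R :=
  (int_from0 psi (y + c) - int_from0 psi y) / c.

Lemma is_derive_shift_sub (w dw : R -> R) (c y : R) :
  (forall z, is_derive w z (dw z)) ->
  is_derive (fun z => (w (z + c) - w z) / c) y ((dw (y + c) - dw y) / c).
Proof.
intros H; unfold Rdiv.
apply (is_derive_ext (fun z => / c * (w (z + c) - w z))); [intros; simpl; ring|].
rewrite (Rmult_comm _ (/ c)).
apply (is_derive_scal (fun z => w (z + c) - w z)).
apply (is_derive_minus (V := R_NormedModule) (fun z => w (z + c)) w); [|apply H].
replace (dw (y + c)) with (scal 1 (dw (y + c))) by (unfold scal; simpl; unfold mult; simpl; ring).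
apply (is_derive_comp (V := R_NormedModule) w (fun z => z + c)); [apply H|].
auto_derive; [easy|ring].
Qed.

Lemma is_derive_steklov (c : R) (psi : R -> R) : (forall z, continuous psi z) ->
  forall y, is_derive (steklov c psi) y ((psi (y + c) - psi y) / c).
Proof.
intros H y; apply is_derive_shift_sub, is_derive_int_from0, H.
Qed.

Lemma continuous_of_derive (w dw : R -> R) :
  (forall z, is_derive w z (dw z)) -> forall z, continuous w z.
Proof. intros H z; apply @ex_derive_continuous; exists (dw z); apply H. Qed.

Lemma continuous_steklov (c : R) (psi : R -> R) : (forall z, continuous psi z) ->
  forall z, continuous (steklov c psi) z.
Proof.
intros H; apply (continuous_of_derive _ (fun y => (psi (y + c) - psi y) / c)).
now apply is_derive_steklov.
Qed.

(** A change of variable writes the means of steps [c], [2 c], [3 c] as integrals over one parameter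
    [s] in [[0,1]]. The mean value theorem for their combination [F] yields a common [s], so a
    pointwise bound passes to the means without integrating an inequality. *)
Lemma steklov_average (p1 p2 p3 : R -> R) (c y1 y2 y3 k e : R) : 0 < c ->
  (forall z, continuous p1 z) -> (forall z, continuous p2 z) ->
  (forall z, continuous p3 z) ->
  (forall s, 0 <= s <= 1 ->
    Rabs (3 * p1 (y1 + c * s) - 3 * p2 (y2 + 2 * c * s) + p3 (y3 + 3 * c * s) - k) <= e) ->
  Rabs (3 * steklov c p1 y1 - 3 * steklov (2 * c) p2 y2 + steklov (3 * c) p3 y3 - k) <= e.
Proof.
intros Hc C1 C2 C3 H.
set (F := fun s => 3 * (int_from0 p1 (y1 + c * s) / c)
  - 3 * (int_from0 p2 (y2 + 2 * c * s) / (2 * c))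
  + int_from0 p3 (y3 + 3 * c * s) / (3 * c) - k * s).
assert (D : forall (p : R -> R) y b s, 0 < b -> (forall z, continuous p z) ->
  is_derive (fun s => int_from0 p (y + b * s) / b) s (p (y + b * s))).
  intros p y b s Hb Cp.
  assert (Dp := is_derive_int_from0 p Cp (y + b * s)).
  auto_derive; [exists (p (y + b * s)); apply Dp|].
  replace (Derive _ _) with (p (y + b * s)) by (symmetry; apply is_derive_unique, Dp).
  field; lra.
destruct (mean_value F (fun s => 3 * p1 (y1 + c * s) - 3 * p2 (y2 + 2 * c * s)
  + p3 (y3 + 3 * c * s) - k) 0 1) as (s & Hs & E); [lra| |].
  intros s; unfold F.
  apply (is_derive_minus (V := R_NormedModule) _ (fun s => k * s));
    [|auto_derive; [easy|ring]].
  apply (is_derive_plus (V := R_NormedModule)); [|apply D; [lra|easy]].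
  apply (is_derive_minus (V := R_NormedModule)
    (fun s => 3 * (int_from0 p1 (y1 + c * s) / c))
    (fun s => 3 * (int_from0 p2 (y2 + 2 * c * s) / (2 * c))));
  apply is_derive_scal; apply D; try easy; lra.
replace (_ - k) with (F 1 - F 0).
  rewrite E, Rminus_0_r, Rmult_1_r; apply H, Hs.
unfold F, steklov; rewrite !Rmult_1_r, !Rmult_0_r, !Rplus_0_r; field; lra.
Qed.

(** * Third differences and the smoothing operator on [[0,1]] *)

Definition third_diff (phi : R -> R) (t x : R) : R :=
  phi (x + 3 * t) - 3 * phi (x + 2 * t) + 3 * phi (x + t) - phi x.

(** Reversing the four sample points changes only the sign of a third difference. Negative steps
    arise because the contraction towards 0 pulls samples to the left of [x]. *)
Lemma third_diff_bound_signed (phi : R -> R) (e h t x : R) :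
  (forall s y, 0 < s <= h -> 0 <= y -> y + 3 * s <= 1 -> Rabs (third_diff phi s y) <= e) ->
  0 <= e -> Rabs t <= h -> 0 <= x <= 1 -> 0 <= x + 3 * t <= 1 ->
  Rabs (third_diff phi t x) <= e.
Proof.
intros H He Ht Hx Hxt; apply Rabs_le_between in Ht.
destruct (Rtotal_order t 0) as [Hneg|[->|Hpos]]; [| |apply H; lra].
  replace (third_diff phi t x) with (- third_diff phi (- t) (x + 3 * t)).
    rewrite Rabs_Ropp; apply H; lra.
  unfold third_diff.
  replace (x + 3 * t + 3 * - t) with x by ring.
  replace (x + 3 * t + 2 * - t) with (x + t) by ring.
  replace (x + 3 * t + - t) with (x + 2 * t) by ring; ring.
unfold third_diff; rewrite !Rmult_0_r, !Rplus_0_r.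
replace (_ - _) with 0 by ring; rewrite Rabs_R0; easy.
Qed.

Lemma is_derive_affine_arg (w dw : R -> R) (b y : R) :
  (forall z, is_derive w z (dw z)) ->
  is_derive (fun z => w (b * z)) y (b * dw (b * y)).
Proof.
intros H.
apply (is_derive_comp (V := R_NormedModule) w (fun z => b * z)); [apply H|].
auto_derive; [easy|ring].
Qed.

Section Smoothing.
Variables (phi : R -> R) (h : R).
Hypothesis phi_cont : forall z, continuous phi z.

Definition steklov_iter (j : R) : nat -> R -> R := fun m => Nat.iter m (steklov (j * (h / 3))) phi.

Lemma continuous_steklov_iter (j : R) (m : nat) : forall z, continuous (steklov_iter j m) z.
Proof. induction m as [|m IH]; [easy|]; apply continuous_steklov, IH. Qed.

Definition shift_quot (j : R) (w : R -> R) (y : R) : R :=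
  (w (y + j * (h / 3)) - w y) / (j * (h / 3)).

(* [piece j i] is the [i]-th derivative of [x |-> A^3 phi ((1 - j h) x)], where A is
   the Steklov mean of step [j h / 3]. Contracting the argument keeps every sample in
   [0,1]: averaging over [sigma] in [0,h], the sample points are [x + j (sigma - h x)]. *)
Definition piece (j : R) (i : nat) (x : R) : R :=
  (1 - j * h) ^ i * Nat.iter i (shift_quot j) (steklov_iter j (3 - i)) ((1 - j * h) * x).

Lemma is_derive_iter_shift_quot (j : R) (w dw : R -> R) (i : nat) :
  (forall z, is_derive w z (dw z)) ->
  forall z, is_derive (Nat.iter i (shift_quot j) w) z (Nat.iter i (shift_quot j) dw z).
Proof.
intros H; induction i as [|i IH]; [easy|].
intros z; apply is_derive_shift_sub, IH.
Qed.

(** Each differentiation trades one Steklov mean for one difference quotient and brings out a factor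
    [1 - j * h]; with [i < 3] a mean is still left to trade. *)
Lemma is_derive_piece (j : R) (i : nat) : (i < 3)%nat ->
  forall z, is_derive (piece j i) z (piece j (S i) z).
Proof.
intros Hi z; unfold piece.
replace (3 - i)%nat with (S (3 - S i)) by lia.
replace ((1 - j * h) ^ S i * _) with
  ((1 - j * h) ^ i * ((1 - j * h) * Nat.iter (S i) (shift_quot j) (steklov_iter j (3 - S i)) ((1 - j * h) * z)))
  by (cbn [pow]; ring).
apply is_derive_scal.
apply (is_derive_affine_arg _ (Nat.iter (S i) (shift_quot j) (steklov_iter j (3 - S i)))).
rewrite Nat.iter_succ_r.
apply is_derive_iter_shift_quot; intros y; apply is_derive_steklov, continuous_steklov_iter.
Qed.

(** The coefficients 3, -3, 1 are those of a third difference without its term [- phi x]: where that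
    difference is small, the other three terms reproduce [phi x]. *)
Definition smooth (i : nat) (x : R) : R :=
  3 * piece 1 i x - 3 * piece 2 i x + piece 3 i x.

Lemma is_derive_smooth (i : nat) : (i < 3)%nat ->
  forall z, is_derive (smooth i) z (smooth (S i) z).
Proof.
intros Hi z; unfold smooth.
apply (is_derive_plus (V := R_NormedModule)); [|now apply is_derive_piece].
apply (is_derive_minus (V := R_NormedModule) (fun x => 3 * piece 1 i x)
  (fun x => 3 * piece 2 i x)); apply is_derive_scal; now apply is_derive_piece.
Qed.

Variable e : R.
Hypothesis h_pos : 0 < h.
Hypothesis h_small : h <= 1 / 4.
Hypothesis e_ge0 : 0 <= e.
Hypothesis phi_diff : forall t x, 0 < t <= h -> 0 <= x -> x + 3 * t <= 1 ->
  Rabs (third_diff phi t x) <= e.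

(** Each of the three averagings yields one parameter [s1], [s2], [s3], common to the three pieces;
    what remains is a single third difference at [x]. *)
Lemma smooth_close (x : R) : 0 <= x <= 1 -> Rabs (smooth 0 x - phi x) <= e.
Proof.
intros Hx; unfold smooth, piece; cbn [pow Nat.iter Nat.sub nat_rect]; unfold steklov_iter.
cbn [Nat.iter nat_rect].
replace (1 * (h / 3)) with (h / 3) by ring; rewrite !Rmult_1_l.
apply steklov_average; try (intros; now repeat apply continuous_steklov); [lra|].
intros s1 Hs1.
apply steklov_average; try (intros; now repeat apply continuous_steklov); [lra|].
intros s2 Hs2.
apply steklov_average; try easy; [lra|].
intros s3 Hs3.
(* The sample of [piece j] is [x + j * t] with the same [t] for all [j]. The last one,
   [(1 - 3 * h) * x + h * (s1 + s2 + s3)], stays in [[0,1]]. *)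
set (t := h / 3 * (s1 + s2 + s3) - h * x).
replace (_ - phi x) with (third_diff phi t x).
  assert (0 <= h * x <= h) by nra.
  assert (0 <= h / 3 * (s1 + s2 + s3) <= h) by nra.
  apply third_diff_bound_signed with h; try easy.
    unfold t; apply Rabs_le; lra.
  unfold t; nra.
unfold third_diff.
replace (x + 3 * t) with ((1 - 3 * h) * x + 3 * (h / 3) * s1 + 3 * (h / 3) * s2
  + 3 * (h / 3) * s3) by (unfold t; field).
replace (x + 2 * t) with ((1 - 2 * h) * x + 2 * (h / 3) * s1 + 2 * (h / 3) * s2
  + 2 * (h / 3) * s3) by (unfold t; field).
replace (x + t) with ((1 - h) * x + (h / 3) * s1 + (h / 3) * s2
  + (h / 3) * s3) by (unfold t; field).
ring.
Qed.

(** Three derivatives use up the three means and leave a third difference of [phi] divided by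
    [c ^ 3]; 27 comes from [c >= h / 3]. *)
Lemma piece3_bound (j x : R) : 1 <= j <= 3 -> 0 <= x <= 1 ->
  Rabs (piece j 3 x) <= 27 * (e / h ^ 3).
Proof.
intros Hj Hx; unfold piece.
set (y := (1 - j * h) * x); set (c := j * (h / 3)).
assert (Hc : h / 3 <= c <= h) by (unfold c; nra).
assert (Hjh : 0 <= 1 - j * h <= 1) by nra.
(* As [3 * c = j * h], the contraction leaves exactly the room needed by a third difference of step
   [c]. *)
assert (Hy : 0 <= y <= 1 - 3 * c).
  unfold y, c; split; [apply Rmult_le_pos; lra|].
  replace (1 - 3 * _) with ((1 - j * h) * 1) by field.
  apply Rmult_le_compat_l; lra.
replace (Nat.iter 3 (shift_quot j) (steklov_iter j (3 - 3)) y) with (/ c ^ 3 * third_diff phi c y).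
  assert (ic : 0 <= / c ^ 3 <= 27 * / h ^ 3).
    rewrite <- !pow_inv; replace (27 * (/ h) ^ 3) with ((3 * / h) ^ 3) by ring.
    assert (0 < / c) by (apply Rinv_0_lt_compat; lra).
    assert (/ c <= 3 * / h).
      replace (3 * / h) with (/ (h / 3)) by (field; lra).
      apply Rinv_le_contravar; lra.
    split; [apply pow_le; lra|apply pow_incr; lra].
  rewrite !Rabs_mult, (Rabs_pos_eq ((1 - j * h) ^ 3)) by (apply pow_le; lra).
  rewrite (Rabs_pos_eq (/ _)) by lra.
  assert (Hp : 0 <= (1 - j * h) ^ 3 <= 1).
    split; [apply pow_le; lra|rewrite <- (pow1 3); apply pow_incr; lra].
  assert (Hd : 0 <= Rabs (third_diff phi c y) <= e).
    split; [apply Rabs_pos|apply phi_diff; lra].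
  apply Rle_trans with (1 * (27 * / h ^ 3 * e)); [|right; unfold Rdiv; ring].
  apply Rmult_le_compat; try easy.
    apply Rmult_le_pos; easy.
  apply Rmult_le_compat; easy.
cbn [Nat.iter Nat.sub nat_rect steklov_iter]; unfold steklov_iter, shift_quot; cbn [Nat.iter nat_rect]; fold c.
unfold third_diff.
replace (y + c + c + c) with (y + 3 * c) by ring.
replace (y + c + c) with (y + 2 * c) by ring.
field; lra.
Qed.

(** [189 = 27 * (3 + 3 + 1)]. *)
Lemma smooth3_bound (x : R) : 0 <= x <= 1 -> Rabs (smooth 3 x) <= 189 * (e / h ^ 3).
Proof.
intros Hx; unfold smooth.
assert (H1 := piece3_bound 1 x ltac:(lra) Hx).
assert (H2 := piece3_bound 2 x ltac:(lra) Hx).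
assert (H3 := piece3_bound 3 x ltac:(lra) Hx).
apply Rabs_le_between in H1; apply Rabs_le_between in H2; apply Rabs_le_between in H3.
apply Rabs_le; lra.
Qed.

End Smoothing.

(** [w1] is meant as the derivative of the approximant [u], so that [w4] is its fourth
    derivative. *)
Lemma smooth_approx (phi : R -> R) (h e : R) :
  (forall z, continuous phi z) -> 0 < h <= 1 / 4 -> 0 <= e ->
  (forall t x, 0 < t <= h -> 0 <= x -> x + 3 * t <= 1 ->
     Rabs (third_diff phi t x) <= e) ->
  exists w1 w2 w3 w4 : R -> R,
    (forall z, is_derive w1 z (w2 z)) /\ (forall z, is_derive w2 z (w3 z)) /\
    (forall z, is_derive w3 z (w4 z)) /\
    forall x, 0 <= x <= 1 ->
      Rabs (w1 x - phi x) <= e /\ Rabs (w4 x) <= 189 * (e / h ^ 3).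
Proof.
intros Hc Hh He Hd.
exists (smooth phi h 0), (smooth phi h 1), (smooth phi h 2), (smooth phi h 3).
repeat split; try (apply is_derive_smooth; [easy|lia]).
  apply smooth_close; easy || lra.
apply smooth3_bound; easy || lra.
Qed.

(** * Taylor remainders, covariances and the two bounds on the bilinear form *)

Lemma taylor_remainder (u u1 u2 u3 : R -> R) (m x t : R) :
  0 <= x <= 1 -> 0 <= t <= 1 ->
  (forall z, is_derive u z (u1 z)) -> (forall z, is_derive u1 z (u2 z)) ->
  (forall z, is_derive u2 z (u3 z)) ->
  (forall z, 0 <= z <= 1 -> Rabs (u2 z) <= m /\ Rabs (u3 z) <= m) ->
  Rabs (u t - u x - u1 x * (t - x)) <= m * (t - x) ^ 2 /\
  Rabs (u t - u x - u1 x * (t - x) - u2 x / 2 * (t - x) ^ 2) <= m * Rabs (t - x) ^ 3.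
Proof.
intros Hx Ht H1 H2 H3 Hm.
assert (m0 : 0 <= m) by (apply Rle_trans with (2 := proj1 (Hm x Hx)); apply Rabs_pos).
assert (Hr := Rabs_pos (t - x)).
set (r := Rabs (t - x)) in *.
assert (Er : (t - x) ^ 2 = r ^ 2) by (unfold r; rewrite RPow_abs, Rabs_pos_eq; [easy|apply pow2_ge_0]).
(* From here on every remainder is bounded through its derivative, a remainder of one order lower;
   the factors 1/2 and 1/6 of Taylor's formula are given up. *)
assert (A1 : forall z, 0 <= z <= 1 -> Rabs (z - x) <= r -> Rabs (u1 z - u1 x) <= m * r).
  intros z Hz Hzr; apply Rle_trans with (m * Rabs (z - x)).
    apply (lipschitz_of_derive u1 u2); try easy; intros; now apply Hm.
  now apply Rmult_le_compat_l.
assert (A2 : forall z, 0 <= z <= 1 -> Rabs (z - x) <= r -> Rabs (u2 z - u2 x) <= m * r).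
  intros z Hz Hzr; apply Rle_trans with (m * Rabs (z - x)).
    apply (lipschitz_of_derive u2 u3); try easy; intros; now apply Hm.
  now apply Rmult_le_compat_l.
assert (A3 : forall z, 0 <= z <= 1 -> Rabs (z - x) <= r ->
  Rabs (u1 z - u1 x - u2 x * (z - x)) <= m * r ^ 2).
  intros z Hz Hzr.
  replace (_ - _ * (z - x)) with
    ((u1 z - u2 x * (z - x)) - (u1 x - u2 x * (x - x))) by ring.
  apply Rle_trans with (m * r * Rabs (z - x)).
    apply (lipschitz_of_derive (fun z => u1 z - u2 x * (z - x)) (fun z => u2 z - u2 x)); try easy.
      intros y; apply (is_derive_minus (V := R_NormedModule) u1); [easy|].
      auto_derive; [easy|ring].
    intros y Hy Hyz; apply A2; lra.
  replace (m * r ^ 2) with (m * r * r) by ring.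
  apply Rmult_le_compat_l; [now apply Rmult_le_pos|easy].
split.
  replace (_ - _ * (t - x)) with
    ((u t - u1 x * (t - x)) - (u x - u1 x * (x - x))) by ring.
  replace (m * _) with (m * r * r) by (rewrite Er; ring).
  apply (lipschitz_of_derive (fun z => u z - u1 x * (z - x)) (fun z => u1 z - u1 x)); try easy.
  intros y; apply (is_derive_minus (V := R_NormedModule) u); [easy|].
  auto_derive; [easy|ring].
replace (_ - _ * (t - x) ^ 2) with
  ((u t - u1 x * (t - x) - u2 x / 2 * (t - x) ^ 2)
   - (u x - u1 x * (x - x) - u2 x / 2 * (x - x) ^ 2)) by (simpl; ring).
replace (m * _) with (m * r ^ 2 * r) by ring.
apply (lipschitz_of_derive (fun z => u z - u1 x * (z - x) - u2 x / 2 * (z - x) ^ 2)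
  (fun z => u1 z - u1 x - u2 x * (z - x))); try easy.
intros y; apply (is_derive_minus (V := R_NormedModule) (fun z => u z - u1 x * (z - x)));
  [apply (is_derive_minus (V := R_NormedModule) u); [easy|]|];
  auto_derive; try easy; field.
Qed.

Definition cov (x : R) (n : nat) (a b : nat -> R) : R :=
  binexp x n (fun k => a k * b k) - binexp x n a * binexp x n b.

Lemma cov_sym (x : R) (n : nat) (a b : nat -> R) : cov x n a b = cov x n b a.
Proof.
unfold cov; rewrite (binexp_ext _ _ (fun k => a k * b k) (fun k => b k * a k))
  by (intros; ring); ring.
Qed.

Lemma cov_plus_l (x : R) (n : nat) (a b c : nat -> R) :
  cov x n (fun k => a k + b k) c = cov x n a c + cov x n b c.
Proof.
unfold cov; rewrite binexp_plus.
rewrite (binexp_ext _ _ (fun k => (a k + b k) * c k) (fun k => a k * c k + b k * c k))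
  by (intros; ring).
rewrite binexp_plus; ring.
Qed.

Lemma cov_ext (x : R) (n : nat) (a b c d : nat -> R) :
  (forall k, (k <= n)%nat -> a k = b k) -> (forall k, (k <= n)%nat -> c k = d k) ->
  cov x n a c = cov x n b d.
Proof.
intros H1 H2; unfold cov.
rewrite (binexp_ext _ _ a b H1), (binexp_ext _ _ c d H2).
rewrite (binexp_ext _ _ (fun k => a k * c k) (fun k => b k * d k)); [easy|].
intros k Hk; now rewrite H1, H2.
Qed.

Lemma cov_const_l (x : R) (n : nat) (c : R) (a : nat -> R) : cov x n (fun _ => c) a = 0.
Proof. unfold cov; rewrite binexp_scal, binexp_const; ring. Qed.

Lemma cov_shift (x : R) (n : nat) (a b : nat -> R) (c d : R) :
  cov x n (fun k => a k - c) (fun k => b k - d) = cov x n a b.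
Proof.
unfold Rminus; rewrite cov_plus_l, cov_const_l, Rplus_0_r.
rewrite cov_sym, cov_plus_l, cov_const_l, Rplus_0_r; apply cov_sym.
Qed.

Lemma node_range (n k : nat) : (1 <= n)%nat -> (k <= n)%nat -> 0 <= INR k / INR n <= 1.
Proof.
intros Hn Hk; assert (0 < INR n) by (apply lt_0_INR; lia).
split; [apply Rmult_le_pos; [apply pos_INR|left; now apply Rinv_0_lt_compat]|].
apply Rmult_le_reg_r with (INR n); [easy|].
replace (_ / _ * _) with (INR k) by (field; lra).
rewrite Rmult_1_l; now apply le_INR.
Qed.

(** The derivatives are separate arguments, which makes the expression bilinear in the pairs
    [(f, df)] and [(g, dg)] by pure algebra. *)
Definition voronovskaya_error (n : nat) (x : R) (f df g dg : R -> R) : R :=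
  INR n * cov x n (fun k => f (INR k / INR n)) (fun k => g (INR k / INR n))
  - x * (1 - x) * df x * dg x.

Lemma error_split_l (n : nat) (x : R) (f df u du g dg : R -> R) :
  voronovskaya_error n x f df g dg =
  voronovskaya_error n x (fun z => f z - u z) (fun z => df z - du z) g dg
  + voronovskaya_error n x u du g dg.
Proof.
unfold voronovskaya_error.
rewrite (cov_ext x n (fun k => f (INR k / INR n))
  (fun k => (f (INR k / INR n) - u (INR k / INR n)) + u (INR k / INR n))
  (fun k => g (INR k / INR n)) (fun k => g (INR k / INR n)));
  [|intros; ring|easy].
rewrite cov_plus_l; ring.
Qed.

Lemma error_sym (n : nat) (x : R) (f df g dg : R -> R) :
  voronovskaya_error n x f df g dg = voronovskaya_error n x g dg f df.
Proof. unfold voronovskaya_error; rewrite cov_sym; ring. Qed.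

(** After centring at [f x] and [g x], the mean of the product, the product of the means and the
    derivative term each contribute at most [lf * lg * X], hence the 3. *)
Lemma error_lipschitz (n : nat) (x lf lg : R) (f df g dg : R -> R) :
  (1 <= n)%nat -> 0 <= x <= 1 ->
  (forall z, is_derive f z (df z)) -> (forall z, is_derive g z (dg z)) ->
  (forall z, 0 <= z <= 1 -> Rabs (df z) <= lf) ->
  (forall z, 0 <= z <= 1 -> Rabs (dg z) <= lg) ->
  Rabs (voronovskaya_error n x f df g dg) <= 3 * (x * (1 - x)) * (lf * lg).
Proof.
intros Hn Hx Df Dg Lf Lg.
destruct (dev_moments x n Hn Hx) as (M1 & M2 & _ & _).
set (X := x * (1 - x)) in *.
assert (HX : 0 <= X) by (apply Rmult_le_pos; lra).
assert (HN : 1 <= INR n) by (apply (le_INR 1); lia).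
assert (f0 : 0 <= lf) by (apply Rle_trans with (2 := Lf x Hx); apply Rabs_pos).
assert (g0 : 0 <= lg) by (apply Rle_trans with (2 := Lg x Hx); apply Rabs_pos).
assert (l0 : 0 <= lf * lg) by now apply Rmult_le_pos.
assert (lip : forall (h dh : R -> R) l, (forall z, is_derive h z (dh z)) ->
  (forall z, 0 <= z <= 1 -> Rabs (dh z) <= l) -> forall k, (k <= n)%nat ->
  Rabs (h (INR k / INR n) - h x) <= l * Rabs (dev x n k)).
  intros h dh l Dh Lh k Hk; apply (lipschitz_of_derive h dh); try easy.
    now apply node_range.
  intros; now apply Lh.
unfold voronovskaya_error.
rewrite <- (cov_shift _ _ _ _ (f x) (g x)); unfold cov.
set (a := fun k => f (INR k / INR n) - f x).
set (b := fun k => g (INR k / INR n) - g x).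
assert (Ha : forall k, (k <= n)%nat -> Rabs (a k) <= lf * Rabs (dev x n k)) by now apply (lip f df).
assert (Hb : forall k, (k <= n)%nat -> Rabs (b k) <= lg * Rabs (dev x n k)) by now apply (lip g dg).
assert (B1 : Rabs (binexp x n (fun k => a k * b k)) <= lf * lg * (X / INR n)).
  rewrite <- M2, <- binexp_scal; apply binexp_Rabs; [easy|intros k Hk].
  rewrite Rabs_mult, <- (Rabs_pos_eq (dev x n k ^ 2)), <- RPow_abs by apply pow2_ge_0.
  replace (lf * lg * _) with ((lf * Rabs (dev x n k)) * (lg * Rabs (dev x n k))) by ring.
  apply Rmult_le_compat; auto using Rabs_pos.
set (s := binexp x n (fun k => Rabs (dev x n k))).
assert (Hs : s ^ 2 <= X / INR n).
  rewrite <- M2; unfold s; apply Rle_trans with (1 := binexp_sqr_le _ _ _ Hx).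
  right; apply binexp_ext; intros; rewrite RPow_abs, Rabs_pos_eq; [easy|apply pow2_ge_0].
assert (B2 : Rabs (binexp x n a * binexp x n b) <= lf * lg * (X / INR n)).
  apply Rle_trans with (lf * lg * s ^ 2); [|now apply Rmult_le_compat_l].
  rewrite Rabs_mult.
  replace (lf * lg * _) with ((lf * s) * (lg * s)) by ring.
  apply Rmult_le_compat; try apply Rabs_pos; unfold s; rewrite <- binexp_scal;
    now apply binexp_Rabs.
assert (B3 : Rabs (X * df x * dg x) <= lf * lg * X).
  rewrite Rmult_assoc, Rmult_comm, Rabs_mult, (Rabs_pos_eq X), Rabs_mult by easy.
  apply Rmult_le_compat_r; [easy|].
  apply Rmult_le_compat; auto using Rabs_pos.
apply Rabs_le_between in B1; apply Rabs_le_between in B2; apply Rabs_le_between in B3.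
assert (E : X / INR n * INR n = X) by (field; lra).
apply Rabs_le; fold X.
set (p := binexp x n (fun k => a k * b k)) in *.
change (binexp x n (fun k => (f (INR k / INR n) - f x) * (g (INR k / INR n) - g x)))
  with p.
set (q := binexp x n a * binexp x n b) in *.
set (v := lf * lg * (X / INR n)) in *.
assert (Hv : INR n * v = lf * lg * X) by (unfold v; rewrite <- E at 2; ring).
assert (INR n * (p - q) <= INR n * (2 * v)) by (apply Rmult_le_compat_l; lra).
assert (INR n * (- (2 * v)) <= INR n * (p - q)) by (apply Rmult_le_compat_l; lra).
lra.
Qed.

(** The linear Taylor parts contribute exactly the derivative term and cancel it. The delicate terms
    pair a linear part with a remainder: the bound of the remainder by [dev ^ 2] would leave the
    third absolute moment, of order [n^(-3/2)], and lose a factor [sqrt n]. One more Taylor term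
    replaces it by the signed third moment and the fourth moment, both at most of order
    [X / n ^ 2]. *)
Lemma error_smooth (n : nat) (x mu mv : R) (u u1 u2 u3 v v1 v2 v3 : R -> R) :
  (1 <= n)%nat -> 0 <= x <= 1 ->
  (forall z, is_derive u z (u1 z)) -> (forall z, is_derive u1 z (u2 z)) ->
  (forall z, is_derive u2 z (u3 z)) ->
  (forall z, is_derive v z (v1 z)) -> (forall z, is_derive v1 z (v2 z)) ->
  (forall z, is_derive v2 z (v3 z)) ->
  (forall z, 0 <= z <= 1 -> Rabs (u1 z) <= mu /\ Rabs (u2 z) <= mu /\ Rabs (u3 z) <= mu) ->
  (forall z, 0 <= z <= 1 -> Rabs (v1 z) <= mv /\ Rabs (v2 z) <= mv /\ Rabs (v3 z) <= mv) ->
  Rabs (voronovskaya_error n x u u1 v v1) <= 9 * (x * (1 - x)) * (mu * mv / INR n).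
Proof.
intros Hn Hx U1 U2 U3 V1 V2 V3 Mu Mv.
destruct (dev_moments x n Hn Hx) as (M1 & M2 & M3 & M4).
set (X := x * (1 - x)) in *.
assert (HX : 0 <= X <= 1) by (unfold X; split; [apply Rmult_le_pos|nra]; lra).
assert (HN : 1 <= INR n) by (apply (le_INR 1); lia).
assert (u0 : 0 <= mu) by (apply Rle_trans with (2 := proj1 (Mu x Hx)); apply Rabs_pos).
assert (v0 : 0 <= mv) by (apply Rle_trans with (2 := proj1 (Mv x Hx)); apply Rabs_pos).
set (q := X / INR n ^ 2) in *.
assert (q0 : 0 <= q).
  apply Rmult_le_pos; [lra|rewrite <- pow_inv; apply pow_le; left; apply Rinv_0_lt_compat; lra].
replace (2 * X / INR n ^ 2) with (2 * q) in M4 by (unfold q, Rdiv; ring).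
set (rem := fun (h h1 : R -> R) k => h (INR k / INR n) - h x - h1 x * dev x n k).
assert (key : forall (h h1 h2 h3 : R -> R) m, 0 <= m ->
  (forall z, is_derive h z (h1 z)) -> (forall z, is_derive h1 z (h2 z)) ->
  (forall z, is_derive h2 z (h3 z)) ->
  (forall z, 0 <= z <= 1 -> Rabs (h1 z) <= m /\ Rabs (h2 z) <= m /\ Rabs (h3 z) <= m) ->
  (forall k, (k <= n)%nat -> Rabs (rem h h1 k) <= m * dev x n k ^ 2) /\
  Rabs (binexp x n (rem h h1)) <= m * (X / INR n) /\
  Rabs (binexp x n (fun k => dev x n k * rem h h1 k)) <= 3 * (m * q)).
  intros h h1 h2 h3 m m0 D1 D2 D3 B.
  assert (T : forall k, (k <= n)%nat ->
    Rabs (rem h h1 k) <= m * dev x n k ^ 2 /\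
    Rabs (rem h h1 k - h2 x / 2 * dev x n k ^ 2) <= m * Rabs (dev x n k) ^ 3).
    intros k Hk; apply (taylor_remainder h h1 h2 h3); try easy.
      now apply node_range.
    intros; split; now apply B.
  split; [intros k Hk; now apply T|split].
    rewrite <- M2, <- binexp_scal; apply binexp_Rabs; [easy|intros k Hk; now apply T].
  rewrite (binexp_ext _ _ _ (fun k => h2 x / 2 * dev x n k ^ 3
    + dev x n k * (rem h h1 k - h2 x / 2 * dev x n k ^ 2))) by (intros; ring).
  rewrite binexp_plus, binexp_scal.
  apply Rle_trans with (1 := Rabs_triang _ _).
  replace (3 * (m * q)) with (m * q + m * (2 * q)) by ring.
  apply Rplus_le_compat.
    rewrite Rabs_mult; apply Rmult_le_compat; try apply Rabs_pos; [|easy].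
    destruct (B x Hx) as (_ & B2 & _).
    unfold Rdiv; rewrite Rabs_mult, (Rabs_pos_eq (/ 2)) by lra.
    generalize (Rabs_pos (h2 x)); lra.
  apply Rle_trans with (m * binexp x n (fun k => dev x n k ^ 4));
    [|now apply Rmult_le_compat_l].
  rewrite <- binexp_scal; apply binexp_Rabs; [easy|intros k Hk].
  rewrite Rabs_mult.
  replace (dev x n k ^ 4) with (Rabs (dev x n k) ^ 4).
    replace (m * _) with (Rabs (dev x n k) * (m * Rabs (dev x n k) ^ 3)) by ring.
    apply Rmult_le_compat_l; [apply Rabs_pos|now apply T].
  rewrite RPow_abs, Rabs_pos_eq; [easy|].
  replace (dev x n k ^ 4) with ((dev x n k ^ 2) ^ 2) by ring; apply pow2_ge_0.
destruct (key u u1 u2 u3 mu u0 U1 U2 U3 Mu) as (Ru & Eu & Yu).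
destruct (key v v1 v2 v3 mv v0 V1 V2 V3 Mv) as (Rv & Ev & Yv).
clear key.
destruct (Mu x Hx) as (Bu & _); destruct (Mv x Hx) as (Bv & _).
set (a := rem u u1) in *; set (b := rem v v1) in *.
assert (B1 : Rabs (binexp x n (fun k => a k * b k)) <= 2 * (mu * mv * q)).
  replace (2 * (mu * mv * q)) with (mu * mv * (2 * q)) by ring.
  apply Rle_trans with (mu * mv * binexp x n (fun k => dev x n k ^ 4));
    [|apply Rmult_le_compat_l; [now apply Rmult_le_pos|easy]].
  rewrite <- binexp_scal; apply binexp_Rabs; [easy|intros k Hk].
  rewrite Rabs_mult.
  replace (mu * mv * _) with ((mu * dev x n k ^ 2) * (mv * dev x n k ^ 2)) by ring.
  apply Rmult_le_compat; auto using Rabs_pos.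
assert (B2 : Rabs (binexp x n a * binexp x n b) <= mu * mv * q).
  rewrite Rabs_mult.
  apply Rle_trans with ((mu * (X / INR n)) * (mv * (X / INR n))).
    apply Rmult_le_compat; auto using Rabs_pos.
  (* The product of the means carries [X ^ 2]; one factor is dropped by [X <= 1]. *)
  replace (_ * _) with (mu * mv * q * X) by (unfold q; field; lra).
  rewrite <- (Rmult_1_r (mu * mv * q)) at 2; apply Rmult_le_compat_l; [|easy].
  apply Rmult_le_pos; [now apply Rmult_le_pos|easy].
assert (B3 : Rabs (u1 x * binexp x n (fun k => dev x n k * b k)) <= 3 * (mu * mv * q)).
  rewrite Rabs_mult; replace (3 * (mu * mv * q)) with (mu * (3 * (mv * q))) by ring.
  apply Rmult_le_compat; auto using Rabs_pos.
assert (B4 : Rabs (v1 x * binexp x n (fun k => dev x n k * a k)) <= 3 * (mu * mv * q)).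
  rewrite Rabs_mult; replace (3 * (mu * mv * q)) with (mv * (3 * (mu * q))) by ring.
  apply Rmult_le_compat; auto using Rabs_pos.
unfold voronovskaya_error; fold X.
assert (E : cov x n (fun k => u (INR k / INR n)) (fun k => v (INR k / INR n))
  = u1 x * v1 x * (X / INR n)
    + (u1 x * binexp x n (fun k => dev x n k * b k)
    + v1 x * binexp x n (fun k => dev x n k * a k)
    + binexp x n (fun k => a k * b k) - binexp x n a * binexp x n b)).
  rewrite <- (cov_shift _ _ _ _ (u x) (v x)).
  rewrite (cov_ext _ _ _ (fun k => u1 x * dev x n k + a k)
    _ (fun k => v1 x * dev x n k + b k));
    try (intros; unfold a, b, rem; ring).
  unfold cov.
  rewrite (binexp_ext _ _ _ (fun k => u1 x * v1 x * dev x n k ^ 2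
    + u1 x * (dev x n k * b k) + v1 x * (dev x n k * a k) + a k * b k)) by (intros; ring).
  rewrite !binexp_plus, !binexp_scal, M2, M1; ring.
rewrite E; clear E.
apply Rabs_le_between in B1; apply Rabs_le_between in B2;
apply Rabs_le_between in B3; apply Rabs_le_between in B4.
rewrite Rmult_plus_distr_l.
match goal with |- context [INR n * (u1 x * v1 x * _) + INR n * ?w] => set (r := w) end.
replace (INR n * (u1 x * v1 x * (X / INR n)) + INR n * r - X * u1 x * v1 x)
  with (INR n * r) by (field; lra).
rewrite Rabs_mult, (Rabs_pos_eq (INR n)) by lra.
replace (9 * X * (mu * mv / INR n)) with (INR n * (9 * (mu * mv * q)))
  by (unfold q; field; lra).
apply Rmult_le_compat_l; [lra|].
(* [9 = 2 + 1 + 3 + 3], from [B1] to [B4]. *)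
apply Rabs_le; unfold r; lra.
Qed.

(* Any constant at least 5000 * 12098 works; see [landau_bound] and [smooth3_bound]. *)
Definition K_approx : R := 100000000.

(** * The smooth approximant and the four-term splitting *)

Lemma approximant (f df : R -> R) (n : nat) (a e : R) : (1 <= n)%nat ->
  (forall z, is_derive f z (df z)) -> (forall z, continuous df z) ->
  (forall z, 0 <= z <= 1 -> Rabs (f z) <= a) -> 0 <= e ->
  (forall t x, 0 < t <= Rpower (INR n) (- (1 / 6)) -> 0 <= x -> x + 3 * t <= 1 ->
     Rabs (third_diff df t x) <= e) ->
  exists (u u1 u2 u3 : R -> R) (m : R),
    (forall z, is_derive u z (u1 z)) /\ (forall z, is_derive u1 z (u2 z)) /\
    (forall z, is_derive u2 z (u3 z)) /\
    (forall z, 0 <= z <= 1 -> Rabs (df z - u1 z) <= e) /\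
    (forall z, 0 <= z <= 1 -> Rabs (u1 z) <= m /\ Rabs (u2 z) <= m /\ Rabs (u3 z) <= m) /\
    0 <= m <= K_approx * (sqrt (INR n) * Rmax (a / sqrt (INR n)) e).
Proof.
intros Hn Df Cdf Ba He Hd.
assert (HN : 1 <= INR n) by (apply (le_INR 1); lia).
set (d := Rpower (INR n) (- (1 / 6))) in *.
set (r := sqrt (INR n)).
assert (Hr : 1 <= r) by (unfold r; rewrite <- sqrt_1; apply sqrt_le_1; lra).
assert (Hdpos : 0 < d) by apply exp_pos.
assert (Hd1 : d <= 1).
  apply Rle_trans with (Rpower (INR n) 0); [apply Rle_Rpower|rewrite Rpower_O]; lra.
(* The exponent 1/6 is chosen for this identity. *)
assert (Hd3 : d ^ 3 * r = 1).
  unfold r; rewrite <- Rpower_sqrt, <- (Rpower_pow 3 d Hdpos) by lra; unfold d.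
  rewrite Rpower_mult, <- Rpower_plus.
  replace (_ + _) with 0 by (simpl; field); apply Rpower_O; lra.
(* Since [d <= 1], the step [d / 4] satisfies [h <= 1 / 4]; cubing it multiplies 189 by 64, which
   gives the 12096 below. *)
destruct (smooth_approx df (d / 4) e Cdf ltac:(lra) He) as (w1 & w2 & w3 & w4 & D1 & D2 & D3 & B).
  intros; apply Hd; lra.
(* With the constant [f 0], [u - f] vanishes at 0, so the bound [e] on [u' - f'] integrates to the
   same bound on [u - f], and Landau's inequality starts from [|u| <= a + e]. *)
set (u := fun z => f 0 + int_from0 w1 z).
assert (Du : forall z, is_derive u z (w1 z)).
  intros z; unfold u; rewrite <- (Rplus_0_l (w1 z)).
  apply (is_derive_plus (V := R_NormedModule) (fun _ => f 0)).
    apply (is_derive_const (V := R_NormedModule)).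
  apply is_derive_int_from0; now apply (continuous_of_derive w1 w2).
assert (u00 : u 0 = f 0).
  unfold u; rewrite int_from0_0; apply Rplus_0_r.
assert (Bu : forall z, 0 <= z <= 1 -> Rabs (u z) <= a + e).
  intros z Hz.
  assert (H : Rabs ((u z - f z) - (u 0 - f 0)) <= e * Rabs (z - 0)).
    apply (lipschitz_of_derive (fun z => u z - f z) (fun z => w1 z - df z)); try lra.
      intros y; now apply (is_derive_minus (V := R_NormedModule) u f).
    intros y Hy _; now apply B.
  rewrite u00, Rminus_diag, !Rminus_0_r, (Rabs_pos_eq z) in H by lra.
  replace (u z) with (f z + (u z - f z)) by ring.
  apply Rle_trans with (1 := Rabs_triang _ _).
  apply Rplus_le_compat; [now apply Ba|].
  apply Rle_trans with (1 := H); nra.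
assert (B4 : forall z, 0 <= z <= 1 -> Rabs (w4 z) <= 12096 * (e * r)).
  intros z Hz; apply Rle_trans with (1 := proj2 (B z Hz)).
  right; replace (e * r) with (e * r / (d ^ 3 * r)) by (rewrite Hd3; field).
  field; lra.
exists u, w1, w2, w3, (5000 * (a + e + 12096 * (e * r))).
assert (L := landau_bound u w1 w2 w3 w4 _ _ Du D1 D2 D3 Bu B4).
repeat apply conj; try assumption; try exact L.
- intros z Hz; rewrite Rabs_minus_sym; now apply B.
- apply Rle_trans with (2 := proj1 (L 0 ltac:(lra))); apply Rabs_pos.
- assert (Ha := Rmult_le_compat_l r _ _ ltac:(lra) (Rmax_l (a / r) e)).
  assert (Hb := Rmult_le_compat_l r _ _ ltac:(lra) (Rmax_r (a / r) e)).
  replace (r * (a / r)) with a in Ha by (field; lra).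
  assert (e <= e * r) by nra.
  assert (0 <= e * r) by nra.
  unfold K_approx; lra.
Qed.

Lemma error_bound (n : nat) (x af a1f ef ag a1g eg : R) (f df g dg : R -> R)
  (d := Rpower (INR n) (- (1 / 6))) :
  (1 <= n)%nat -> 0 <= x <= 1 ->
  (forall z, is_derive f z (df z)) -> (forall z, continuous df z) ->
  (forall z, is_derive g z (dg z)) -> (forall z, continuous dg z) ->
  (forall z, 0 <= z <= 1 -> Rabs (f z) <= af) ->
  (forall z, 0 <= z <= 1 -> Rabs (g z) <= ag) ->
  (forall z, 0 <= z <= 1 -> Rabs (df z) <= a1f) ->
  (forall z, 0 <= z <= 1 -> Rabs (dg z) <= a1g) ->
  0 <= ef -> 0 <= eg ->
  (forall t y, 0 < t <= d -> 0 <= y -> y + 3 * t <= 1 -> Rabs (third_diff df t y) <= ef) ->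
  (forall t y, 0 < t <= d -> 0 <= y -> y + 3 * t <= 1 -> Rabs (third_diff dg t y) <= eg) ->
  Rabs (voronovskaya_error n x f df g dg) <=
  9 * K_approx ^ 2 * (x * (1 - x)) * (ef * eg + a1f * eg + a1g * ef
    + Rmax (af / sqrt (INR n)) ef * Rmax (ag / sqrt (INR n)) eg).
Proof.
intros Hn Hx Df Cf Dg Cg Bf Bg B1f B1g Ef Eg Tf Tg.
assert (HX : 0 <= x * (1 - x)) by (apply Rmult_le_pos; lra).
assert (HN : 1 <= INR n) by (apply (le_INR 1); lia).
destruct (approximant f df n af ef) as (u & u1 & u2 & u3 & mu & U1 & U2 & U3 & Au & Bu & Mu); try easy.
destruct (approximant g dg n ag eg) as (v & v1 & v2 & v3 & mv & V1 & V2 & V3 & Av & Bv & Mv); try easy.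
(* Splitting acts on the first pair only; the swap brings [g] there before the second round. *)
rewrite (error_split_l _ _ _ _ u u1), (error_sym _ _ (fun z => f z - u z)), (error_sym _ _ u).
rewrite (error_split_l _ _ g dg v v1), (error_split_l _ _ g dg v v1 u u1).
set (X := x * (1 - x)) in *.
assert (Dp : forall z, is_derive (fun z => f z - u z) z (df z - u1 z)).
  intros z; now apply (is_derive_minus (V := R_NormedModule) f u).
assert (Dq : forall z, is_derive (fun z => g z - v z) z (dg z - v1 z)).
  intros z; now apply (is_derive_minus (V := R_NormedModule) g v).
(* The mixed terms need a Lipschitz constant free of the factor [sqrt n] that [mu] and [mv] may
   contain. *)
assert (Lu : forall z, 0 <= z <= 1 -> Rabs (u1 z) <= a1f + ef).
  intros z Hz; replace (u1 z) with (df z - (df z - u1 z)) by ring.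
  apply Rle_trans with (1 := Rabs_triang _ _); rewrite Rabs_Ropp.
  apply Rplus_le_compat; auto.
assert (Lv : forall z, 0 <= z <= 1 -> Rabs (v1 z) <= a1g + eg).
  intros z Hz; replace (v1 z) with (dg z - (dg z - v1 z)) by ring.
  apply Rle_trans with (1 := Rabs_triang _ _); rewrite Rabs_Ropp.
  apply Rplus_le_compat; auto.
assert (E1 := error_lipschitz n x eg ef _ _ _ _ Hn Hx Dq Dp Av Au).
assert (E2 := error_lipschitz n x (a1g + eg) ef _ _ _ _ Hn Hx V1 Dp Lv Au).
assert (E3 := error_lipschitz n x eg (a1f + ef) _ _ _ _ Hn Hx Dq U1 Av Lu).
assert (E4 := error_smooth n x mv mu _ _ _ _ _ _ _ _ Hn Hx V1 V2 V3 U1 U2 U3 Bv Bu).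
fold X in E1, E2, E3, E4; cbv beta in E1.
set (mf := Rmax (af / sqrt (INR n)) ef) in *; set (mg := Rmax (ag / sqrt (INR n)) eg) in *.
(* Each of [mu] and [mv] brings a [sqrt n]; together they absorb the division by [n]. *)
assert (Hm : mv * mu / INR n <= K_approx ^ 2 * (mf * mg)).
  apply Rle_trans with ((K_approx * (sqrt (INR n) * mg)) * (K_approx * (sqrt (INR n) * mf)) / INR n).
    apply Rmult_le_compat_r; [left; apply Rinv_0_lt_compat; lra|].
    apply Rmult_le_compat; lra.
  right; rewrite <- (sqrt_sqrt (INR n)) at 3 by lra.
  assert (0 < sqrt (INR n)) by (apply sqrt_lt_R0; lra).
  field; lra.
assert (a0f : 0 <= a1f) by (apply Rle_trans with (2 := B1f x Hx); apply Rabs_pos).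
assert (a0g : 0 <= a1g) by (apply Rle_trans with (2 := B1g x Hx); apply Rabs_pos).
assert (P1 : 0 <= X * (ef * eg)) by (apply Rmult_le_pos; [easy|now apply Rmult_le_pos]).
assert (P2 : 0 <= X * (a1f * eg)) by (apply Rmult_le_pos; [easy|now apply Rmult_le_pos]).
assert (P3 : 0 <= X * (a1g * ef)) by (apply Rmult_le_pos; [easy|now apply Rmult_le_pos]).
apply (Rmult_le_compat_l (9 * X)) in Hm; [|lra].
eapply Rle_trans; [apply Rabs_triang|].
eapply Rle_trans; [apply Rplus_le_compat; apply Rabs_triang|].
eapply Rle_trans; [apply Rplus_le_compat; apply Rplus_le_compat; eassumption|].
unfold K_approx in *; lra.
Qed.

(** * Extension of C^1 data from [[0,1]] to the line *)

Definition clamp (y : R) : R := Rmax 0 (Rmin 1 y).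

Lemma clamp_range (y : R) : 0 <= clamp y <= 1.
Proof.
unfold clamp; split; [apply Rmax_l|].
apply Rmax_lub; [lra|apply Rmin_l].
Qed.

Lemma clamp_id (y : R) : 0 <= y <= 1 -> clamp y = y.
Proof. intros Hy; unfold clamp; rewrite Rmin_right, Rmax_right; lra. Qed.

Lemma clamp_lipschitz (y z : R) : Rabs (clamp y - clamp z) <= Rabs (y - z).
Proof.
unfold clamp, Rmax, Rmin.
repeat destruct Rle_dec; unfold Rabs; repeat destruct Rcase_abs; lra.
Qed.

(** Clamping is a 1-Lipschitz retraction onto [[0,1]], so continuity relative to the interval
    becomes continuity on the line. *)
Lemma continuous_clamp (h : R -> R) :
  (forall x, 0 <= x <= 1 -> limit1_in h (fun y => 0 <= y <= 1) (h x) x) ->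
  forall z, continuous (fun y => h (clamp y)) z.
Proof.
intros H z; apply continuity_pt_filterlim; intros eps Heps.
destruct (H (clamp z) (clamp_range z) eps Heps) as (al & Hal & Hl).
exists al; split; [easy|intros y [_ Hy]].
apply Hl; split; [apply clamp_range|].
apply Rle_lt_trans with (2 := Hy); apply clamp_lipschitz.
Qed.

(** The clamped derivative is integrated. What needs proof is that [f] minus this primitive is
    constant on [[0,1]]: its derivative vanishes inside and it is continuous up to the endpoints. *)
Lemma C1_extension (f df : R -> R) : C1_on01 f df ->
  exists f' df' : R -> R,
    (forall z, is_derive f' z (df' z)) /\ (forall z, continuous df' z) /\
    forall z, 0 <= z <= 1 -> f' z = f z /\ df' z = df z.
Proof.
intros [Hf Hdf].
set (p := fun y => df (clamp y)).
assert (Cp : forall z, continuous p z) by now apply continuous_clamp.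
set (F := int_from0 p).
assert (DF := is_derive_int_from0 p Cp).
(* In product form the first-order expansion also holds at [y = z], so the excluded base point
   disappears. *)
assert (quot : forall z eps, 0 <= z <= 1 -> 0 < eps -> exists al, 0 < al /\
  forall y, 0 <= y <= 1 -> Rabs (y - z) < al ->
    Rabs (f y - f z - df z * (y - z)) <= eps * Rabs (y - z)).
  intros z eps Hz Heps.
  destruct (Hf z Hz eps Heps) as (al & Hal & Hl).
  exists al; split; [easy|intros y Hy Hyz].
  destruct (Req_dec y z) as [->|Hne].
    replace (_ - _) with 0 by ring; rewrite Rabs_R0, Rminus_diag, Rabs_R0; lra.
  assert (L := Hl y (conj (conj Hy Hne) Hyz)); simpl in L; unfold R_dist in L.
  replace (f y - f z - df z * (y - z)) with (((f y - f z) / (y - z) - df z) * (y - z))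
    by (field; lra).
  rewrite Rabs_mult; apply Rmult_le_compat_r; [apply Rabs_pos|lra].
assert (cst : forall y, 0 <= y <= 1 -> f y - F y = f 0).
  (* [clamp] gives two-sided continuity at 0 and 1, where [f] is known from one side only; the mean
     value theorem asks for a derivative only in the open interval. *)
  set (G := fun y => f (clamp y) - F y).
  assert (CG : forall z, continuous G z).
    intros z; apply (continuous_minus (V := R_NormedModule) (fun y => f (clamp y)) F);
      [|now apply (continuous_of_derive F p)].
    apply continuous_clamp; intros x Hx eps Heps.
    destruct (quot x 1 Hx Rlt_0_1) as (al & Hal & Hq).
    set (k := Rabs (df x) + 1).
    assert (k0 : 0 < k) by (unfold k; generalize (Rabs_pos (df x)); lra).
    exists (Rmin al (eps / k)); split.
      apply Rmin_pos; [easy|now apply Rdiv_lt_0_compat].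
    intros y [Hy Hyx]; simpl in *; unfold R_dist in *.
    assert (Rabs (y - x) < al) by (apply Rlt_le_trans with (1 := Hyx), Rmin_l).
    assert (Rabs (y - x) < eps / k) by (apply Rlt_le_trans with (1 := Hyx), Rmin_r).
    apply Rle_lt_trans with (k * Rabs (y - x)).
      replace (f y - f x) with (df x * (y - x) + (f y - f x - df x * (y - x))) by ring.
      apply Rle_trans with (1 := Rabs_triang _ _); rewrite Rabs_mult.
      specialize (Hq y Hy H); unfold k; lra.
    replace eps with (k * (eps / k)) by (field; lra).
    now apply Rmult_lt_compat_l.
  intros y Hy.
  destruct (MVT_gen G 0 y (fun _ => 0)) as (c & _ & E).
  - rewrite Rmin_left, Rmax_right by lra; intros z Hz.
    apply is_derive_Reals; intros eps Heps.
    assert (DFz := proj1 (is_derive_Reals _ _ _) (DF z) (eps / 2) ltac:(lra)).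
    destruct DFz as (d1 & Hd1).
    destruct (quot z (eps / 2)) as (d2 & Hd2 & Hq); [lra|lra|].
    (* This radius keeps [z + h] inside [[0,1]], so [clamp] can be removed from both values of
       [G]. *)
    assert (dpos : 0 < Rmin (Rmin d1 d2) (Rmin z (1 - z))).
      repeat apply Rmin_pos; try lra; apply cond_pos.
    exists (mkposreal _ dpos); intros h Hh Hhd; simpl in Hhd.
    assert (h1 : Rabs h < d1).
      apply Rlt_le_trans with (1 := Hhd); eapply Rle_trans; apply Rmin_l.
    assert (h2 : Rabs h < d2).
      apply Rlt_le_trans with (1 := Hhd); eapply Rle_trans; [apply Rmin_l|apply Rmin_r].
    assert (h3 : Rabs h < z).
      apply Rlt_le_trans with (1 := Hhd); eapply Rle_trans; [apply Rmin_r|apply Rmin_l].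
    assert (h4 : Rabs h < 1 - z).
      apply Rlt_le_trans with (1 := Hhd); eapply Rle_trans; apply Rmin_r.
    apply Rabs_lt_between in h3; apply Rabs_lt_between in h4.
    specialize (Hd1 h Hh h1).
    assert (Q := Hq (z + h) ltac:(lra)).
    replace (z + h - z) with h in Q by ring.
    specialize (Q h2).
    unfold G; rewrite !clamp_id by lra.
    change (Rabs ((F (z + h) - F z) / h - p z) < eps / 2) in Hd1.
    replace (p z) with (df z) in Hd1 by (unfold p; rewrite clamp_id; lra).
    replace (_ - 0) with ((f (z + h) - f z - df z * h) / h
       + - ((F (z + h) - F z) / h - df z)) by (now field).
    apply Rle_lt_trans with (1 := Rabs_triang _ _); rewrite Rabs_Ropp.
    assert (Rabs ((f (z + h) - f z - df z * h) / h) <= eps / 2).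
      unfold Rdiv at 1; rewrite Rabs_mult, Rabs_inv.
      assert (0 < Rabs h) by now apply Rabs_pos_lt.
      apply Rmult_le_reg_r with (Rabs h); [easy|].
      rewrite Rmult_assoc, Rinv_l, Rmult_1_r; lra.
    lra.
  - intros z _; apply continuity_pt_filterlim, CG.
  - rewrite Rmult_0_l in E; unfold G in E; rewrite !clamp_id in E by lra.
    assert (F 0 = 0) by apply int_from0_0; lra.
exists (fun y => f 0 + F y), p; split; [|split; [easy|intros z Hz; split]].
- intros z; rewrite <- (Rplus_0_l (p z)).
  apply (is_derive_plus (V := R_NormedModule) (fun _ => f 0)); [|apply DF].
  apply (is_derive_const (V := R_NormedModule)).
- rewrite <- (cst z) by easy; ring.
- unfold p; now rewrite clamp_id.
Qed.

(** * Finiteness of the norms and moduli, and the theorem *)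

Lemma le_real_lub (P : R -> Prop) (b r : R) :
  (forall y, P y -> y <= b) -> P r -> r <= real (Lub_Rbar P).
Proof.
intros Hb Hr.
destruct (Lub_Rbar_correct P) as [U L].
specialize (U r Hr); specialize (L (Finite b) Hb).
(* [real] sends both infinities to 0; the member [r] excludes the lower one and the bound [b] the
   upper one. *)
destruct (Lub_Rbar P); easy.
Qed.

Lemma bounded_on_unit (h : R -> R) : (forall z, continuous h z) ->
  exists b, forall z, 0 <= z <= 1 -> Rabs (h z) <= b.
Proof.
intros H.
destruct (continuity_ab_maj (fun z => Rabs (h z)) 0 1 Rle_0_1) as (m & Hm & _).
  intros c _; apply (continuity_pt_comp h Rabs); [|apply Rcontinuity_abs].
  apply continuity_pt_filterlim, H.
now exists (Rabs (h m)).
Qed.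

Lemma le_unorm (h : R -> R) (b z : R) :
  (forall y, 0 <= y <= 1 -> Rabs (h y) <= b) -> 0 <= z <= 1 -> Rabs (h z) <= unorm h.
Proof.
intros Hb Hz; apply le_real_lub with b; [|now exists z].
intros y (t & Ht & ->); now apply Hb.
Qed.

Lemma le_omega3 (h : R -> R) (b d t x : R) :
  (forall y, 0 <= y <= 1 -> Rabs (h y) <= b) ->
  0 < t <= d -> 0 <= x -> x + 3 * t <= 1 -> Rabs (third_diff h t x) <= omega3 h d.
Proof.
intros Hb Ht Hx Hxt; apply le_real_lub with (8 * b); [|now exists x, t].
intros y (z & s & Hs & Hz & Hzs & ->).
assert (A := Hb (z + 3 * s) ltac:(lra)); assert (B := Hb (z + 2 * s) ltac:(lra)).
assert (C := Hb (z + s) ltac:(lra)); assert (D := Hb z ltac:(lra)).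
apply Rabs_le_between in A; apply Rabs_le_between in B.
apply Rabs_le_between in C; apply Rabs_le_between in D.
apply Rabs_le; lra.
Qed.

(** The step [Rmin d (1 / 3)] at 0 is admissible, so the supremum dominates an absolute value. *)
Lemma omega3_ge0 (h : R -> R) (b d : R) : 0 < d ->
  (forall y, 0 <= y <= 1 -> Rabs (h y) <= b) -> 0 <= omega3 h d.
Proof.
intros Hd Hb.
assert (Hm : 0 < Rmin d (1 / 3)) by (apply Rmin_pos; lra).
apply Rle_trans with (Rabs (third_diff h (Rmin d (1 / 3)) 0)); [apply Rabs_pos|].
assert (Hl := Rmin_l d (1 / 3)); assert (Hr := Rmin_r d (1 / 3)).
apply le_omega3 with b; [exact Hb|lra..].
Qed.

Theorem theorem2p4 :
  exists C : R, 0 < C /\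
  forall (f df g dg : R -> R), C1_on01 f df -> C1_on01 g dg ->
  forall (n : nat) (x : R), (1 <= n)%nat -> 0 <= x <= 1 ->
  let d := Rpower (INR n) (- (1 / 6)) in
  INR n * Rabs (bernstein n (fun y => f y * g y) x - bernstein n f x * bernstein n g x
                - x * (1 - x) / INR n * df x * dg x)
  <= C * x * (1 - x) *
     (omega3 df d * omega3 dg d
      + unorm df * omega3 dg d + unorm dg * omega3 df d
      + Rmax (unorm f / sqrt (INR n)) (omega3 df d)
        * Rmax (unorm g / sqrt (INR n)) (omega3 dg d)).
Proof.
(* This is what the term with two smooth functions requires; the other three together have
   coefficients at most 9. *)
exists (9 * K_approx ^ 2); split; [unfold K_approx; lra|].
intros f df g dg Hf Hg n x Hn Hx d.
assert (HN : 1 <= INR n) by (apply (le_INR 1); lia).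
destruct (C1_extension f df Hf) as (F & dF & DF & CF & EF).
destruct (C1_extension g dg Hg) as (G & dG & DG & CG & EG).
(* The estimates concern the extensions, while the norms and moduli are those of the given
   functions; both agree on [[0,1]]. *)
assert (bounds : forall h dh H dH : R -> R, (forall z, is_derive H z (dH z)) ->
  (forall z, continuous dH z) -> (forall z, 0 <= z <= 1 -> H z = h z /\ dH z = dh z) ->
  (forall z, 0 <= z <= 1 -> Rabs (H z) <= unorm h) /\
  (forall z, 0 <= z <= 1 -> Rabs (dH z) <= unorm dh) /\
  0 <= omega3 dh d /\
  (forall t y, 0 < t <= d -> 0 <= y -> y + 3 * t <= 1 ->
     Rabs (third_diff dH t y) <= omega3 dh d)).
  intros h dh H dH D C E.
  destruct (bounded_on_unit H (continuous_of_derive H dH D)) as (b & Hb).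
  destruct (bounded_on_unit dH C) as (b' & Hb').
  assert (hb : forall z, 0 <= z <= 1 -> Rabs (h z) <= b)
    by (intros z Hz; rewrite <- (proj1 (E z Hz)); now apply Hb).
  assert (hb' : forall z, 0 <= z <= 1 -> Rabs (dh z) <= b')
    by (intros z Hz; rewrite <- (proj2 (E z Hz)); now apply Hb').
  repeat apply conj.
  - intros z Hz; rewrite (proj1 (E z Hz)); now apply le_unorm with b.
  - intros z Hz; rewrite (proj2 (E z Hz)); now apply le_unorm with b'.
  - apply omega3_ge0 with b'; [apply exp_pos|easy].
  - intros t y Ht Hy Hyt; unfold third_diff.
    rewrite !(fun z Hz => proj2 (E z Hz)) by lra.
    now apply le_omega3 with b'. 
destruct (bounds f df F dF DF CF EF) as (F1 & F2 & F3 & F4).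
destruct (bounds g dg G dG DG CG EG) as (G1 & G2 & G3 & G4).
clear bounds.
assert (B := error_bound n x _ _ _ _ _ _ F dF G dG Hn Hx DF CF DG CG F1 G1 F2 G2 F3 G3 F4 G4).
fold d in B.
rewrite (Rmult_assoc _ x (1 - x)).
replace (INR n * Rabs _) with (Rabs (voronovskaya_error n x F dF G dG)); [easy|].
assert (scale : forall w, INR n * Rabs w = Rabs (INR n * w)).
  intros w; rewrite Rabs_mult, (Rabs_pos_eq (INR n)); lra.
rewrite scale; f_equal.
unfold voronovskaya_error, bernstein; rewrite !binexp_sum.
rewrite (proj2 (EF x Hx)), (proj2 (EG x Hx)).
rewrite (cov_ext x n _ (fun k => f (INR k / INR n)) _ (fun k => g (INR k / INR n))).
- unfold cov; field; lra.
- intros k Hk; apply EF; now apply node_range.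
- intros k Hk; apply EG; now apply node_range.
Qed.
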